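(* Let $G$ be a finite group. Let $n$ be the number of normal subgroups of $G$ and set \[H_{dB}:=\langle \mathrm{dBInf}_{G/N}^G(-\mathrm{Id}_{G/N})\,|\, N\trianglelefteq G\rangle.\] Then $H_{dB}$ is an elementary abelian $2$-subgroup of $B_{\circ}(G,G)$ of order $2^n$. Moreover, \[B^\Delta_{\circ}(G,G)\cap H_{dB}=\{\pm \mathrm{Id}_G\}.\]
   Context: For finite groups $G,H$, a $(G,H)$-biset is a set with commuting left $G$-action and right $H$-action. $B(G,H)$ denotes the Grothendieck group of isomorphism classes of finite $(G,H)$-bisets with respect to disjoint union. For a $(G,H)$-biset $X$ and an $(H,K)$-biset $Y$, $X\times_H Y$ is the set of $H$-orbits of $X\times Y$ under $h\cdot(x,y)=(xh^{-1},hy)$, with its natural $(G,K)$-biset structure; this induces associative bilinear maps $\circ:B(G,H)\times B(H,K)\to B(G,K)$. The double Burnside ring of $G$ is $B(G,G)$ with multiplication $\circ$; its identity is $\mathrm{Id}_G=[G]$ ($G$ acting on itself by left and right multiplication). The opposite of a $(G,H)$-biset $X$ is the $(H,G)$-biset $X^\circ$ with underlying set $X$ and action $h\cdot x\cdot g=g^{-1}xh^{-1}$; this induces an additive map $(-)^\circ:B(G,H)\to B(H,G)$, which for $G=H$ is an anti-involution of the ring $B(G,G)$. The group of orthogonal units is $B_\circ(G,G)=\{u\in B(G,G)^\times : uu^\circ=u^\circ u=\mathrm{Id}_G\}$. For $N\trianglelefteq G$, $\mathrm{Inf}_{G/N}^G\in B(G,G/N)$ is the class of the set $G/N$ with its natural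 $(G,G/N)$-action, and $\mathrm{Def}_{G/N}^G\in B(G/N,G)$ is the class of $G/N$ with its natural $(G/N,G)$-action. The group homomorphism $\mathrm{dBInf}_{G/N}^G:B_\circ(G/N,G/N)\to B_\circ(G,G)$ is $u\mapsto \mathrm{Id}_G+\mathrm{Inf}_{G/N}^G\circ(u-\mathrm{Id}_{G/N})\circ\mathrm{Def}_{G/N}^G$. For $L\leqslant G\times G$, the coset space $G\times G/L$ is a $(G,G)$-biset via $x\cdot(g_1,g_2)L\cdot y=(xg_1,y^{-1}g_2)L$; the classes $[G\times G/L]$, with $L$ up to conjugacy, form a $\mathbb{Z}$-basis of $B(G,G)$. Put $K_1(L)=\{g\in G: (g,1)\in L\}$ and $K_2(L)=\{h\in G:(1,h)\in L\}$; $L$ is bifree if $K_1(L)=K_2(L)=1$. $B^\Delta(G,G)$ is the subring of $B(G,G)$ spanned by the $[G\times G/L]$ with $L$ bifree, and $B^\Delta_\circ(G,G)=B_\circ(G,G)\cap B^\Delta(G,G)$. *)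

(* Defs.v *)
From HB Require Import structures.
From mathcomp Require Import all_boot all_order all_algebra all_fingroup.
From mathcomp Require Import generic_quotient.
From mathcomp Require Import boolp classical_sets cardinality.

Set Implicit Arguments.
Unset Strict Implicit.
Unset Printing Implicit Defensive.

Import GRing.Theory.

Local Open Scope group_scope.
Local Open Scope quotient_scope.

Section Biset.
Variables gT hT : finGroupType.

Record biset_on (X : Type) := BisetOn {
  lact : gT -> X -> X;
  ract : X -> hT -> X;
  lact1 : forall x, lact 1 x = x;
  lactM : forall g g' x, lact (g * g') x = lact g (lact g' x);
  ract1 : forall x, ract x 1 = x;
  ractM : forall x h h', ract x (h * h') = ract (ract x h) h';
  lractA : forall g x h, lact g (ract x h) = ract (lact g x) h }.

Record biset := Biset { bcarrier :> finType; bstruct :> biset_on bcarrier }.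

Definition biset_iso (X Y : biset) : Prop :=
  exists f : X -> Y, [/\ bijective f,
    forall g x, f (lact X g x) = lact Y g (f x)
    & forall x h, f (ract X x h) = ract Y (f x) h].

Lemma biset_iso_refl X : biset_iso X X.
Proof. by exists id; split=> //; exists id. Qed.

Lemma biset_iso_sym X Y : biset_iso X Y -> biset_iso Y X.
Proof.
case=> f [[k fK kK] fl fr]; exists k; split; first by exists f.
- by move=> g x; apply: (can_inj fK); rewrite fl !kK.
- by move=> x h; apply: (can_inj fK); rewrite fr !kK.
Qed.

Lemma biset_iso_trans X Y Z : biset_iso X Y -> biset_iso Y Z -> biset_iso X Z.
Proof.
case=> f [bf fl fr] [k [bk kl kr]]; exists (k \o f); split.
- exact: bij_comp.
- by move=> g x /=; rewrite fl kl.
- by move=> x h /=; rewrite fr kr.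
Qed.

Section Transport.
Variables (X : biset) (Y : finType) (f : X -> Y) (k : Y -> X).
Hypotheses (fK : cancel f k) (kK : cancel k f).

Definition transport_on : biset_on Y.
Proof.
exists (fun g y => f (lact X g (k y))) (fun y h => f (ract X (k y) h)).
- by move=> y; rewrite lact1.
- by move=> g g' y; rewrite fK lactM.
- by move=> y; rewrite ract1.
- by move=> y h h'; rewrite fK ractM.
- by move=> g y h; rewrite !fK lractA.
Defined.

Definition transport : biset := Biset transport_on.

Lemma transport_iso : biset_iso X transport.
Proof.
by exists f; split; [exists k | move=> g x /=; rewrite fK
                   | move=> x h /=; rewrite fK].
Qed.
End Transport.

Definition sum_biset_on (X Y : biset) : biset_on (X + Y)%type.
Proof.
exists (fun g u => match u with inl x => inl (lact X g x)
                              | inr y => inr (lact Y g y) end)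
       (fun u h => match u with inl x => inl (ract X x h)
                              | inr y => inr (ract Y y h) end).
- by case=> x; rewrite lact1.
- by move=> g g' [] x; rewrite lactM.
- by case=> x; rewrite ract1.
- by move=> [] x h h'; rewrite ractM.
- by move=> g [] x h; rewrite lractA.
Defined.

Definition sum_biset (X Y : biset) : biset := Biset (sum_biset_on X Y).

Definition empty_biset_on : biset_on void.
Proof. by exists (fun _ x => x) (fun x _ => x). Defined.

Definition empty_biset : biset := Biset empty_biset_on.

Lemma sum_bisetS X X' Y Y' : biset_iso X X' -> biset_iso Y Y' ->
  biset_iso (sum_biset X Y) (sum_biset X' Y').
Proof.
case=> f [[f' fK f'K] fl fr] [k [[k' kK k'K] kl kr]].
exists (fun u => match u with inl x => inl (f x) | inr y => inr (k y) end).
split.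
- exists (fun u => match u with inl x => inl (f' x) | inr y => inr (k' y) end).
  + by case=> x; rewrite ?fK ?kK.
  + by case=> x; rewrite ?f'K ?k'K.
- by move=> g [] x /=; rewrite ?fl ?kl.
- by move=> [] x h /=; rewrite ?fr ?kr.
Qed.

Lemma sum_bisetC X Y : biset_iso (sum_biset X Y) (sum_biset Y X).
Proof.
exists (fun u => match u with inl x => inr x | inr y => inl y end).
split; [|by move=> g []|by move=> []].
by exists (fun u => match u with inl x => inr x | inr y => inl y end); case.
Qed.

Lemma sum_bisetA X Y Z :
  biset_iso (sum_biset X (sum_biset Y Z)) (sum_biset (sum_biset X Y) Z).
Proof.
exists (fun u => match u with inl x => inl (inl x)
   | inr (inl y) => inl (inr y) | inr (inr z) => inr z end).
split; [|by move=> g [|[]]|by move=> [|[]]].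
exists (fun u => match u with inl (inl x) => inl x
   | inl (inr y) => inr (inl y) | inr z => inr (inr z) end).
- by case=> [|[]].
- by case=> [[]|].
Qed.

Lemma sum_biset0 X : biset_iso (sum_biset empty_biset X) X.
Proof.
exists (fun u => match u with inl v => of_void X v | inr x => x end).
split; [|by move=> g []|by move=> []].
by exists inr => // -[].
Qed.

(* Every finite biset is isomorphic to one carried by some ['I_n] ([skelP]), so
   isomorphism classes are represented on these carriers: this keeps
   [isoclass] in the universe of small types, whereas [biset] ranges over
   all finite types. *)

Definition skeleton : Type := {n : nat & biset_on 'I_n}.

Definition of_skeleton (s : skeleton) : biset := Biset (projT2 s).

Definition to_skeleton (X : biset) : skeleton :=
  existT _ #|X| (transport_on (@enum_rankK X) (@enum_valK X)).

Lemma skelP X : biset_iso (of_skeleton (to_skeleton X)) X.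
Proof. exact: biset_iso_sym (transport_iso (@enum_rankK X) (@enum_valK X)). Qed.

Definition skel_iso : rel {classic skeleton} :=
  fun s t => `[< biset_iso (of_skeleton s) (of_skeleton t) >].

Lemma skel_iso_refl : reflexive skel_iso.
Proof. by move=> s; apply/asboolP/biset_iso_refl. Qed.
Lemma skel_iso_sym : symmetric skel_iso.
Proof. by move=> s t; apply/asboolP/asboolP; apply: biset_iso_sym. Qed.
Lemma skel_iso_trans : transitive skel_iso.
Proof.
move=> t s r /asboolP st /asboolP tr.
exact/asboolP/(biset_iso_trans st).
Qed.

Canonical skel_iso_equiv :=
  EquivRel skel_iso skel_iso_refl skel_iso_sym skel_iso_trans.

Definition isoclass := {eq_quot skel_iso}.
HB.instance Definition _ := Choice.on isoclass.
HB.instance Definition _ := Quotient.on isoclass.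

Definition iclass (X : biset) : isoclass :=
  (\pi_isoclass (to_skeleton X : {classic skeleton}))%qT.

Definition irepr (c : isoclass) : biset := of_skeleton (repr c).

Lemma iclassP X Y : iclass X = iclass Y <-> biset_iso X Y.
Proof.
split.
- move/eqquotP/asboolP => XY.
  exact: biset_iso_trans (biset_iso_sym (skelP X))
           (biset_iso_trans XY (skelP Y)).
- move=> XY; apply/eqquotP/asboolP.
  exact: biset_iso_trans (skelP X)
           (biset_iso_trans XY (biset_iso_sym (skelP Y))).
Qed.

Lemma ireprK c : iclass (irepr c) = c.
Proof. by rewrite -[RHS]reprK; apply/eqquotP/asboolP/skelP. Qed.

Lemma irepr_iso X : biset_iso (irepr (iclass X)) X.
Proof. by apply/iclassP; rewrite ireprK. Qed.

Lemma iclassW (P : isoclass -> Prop) :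
  (forall X, P (iclass X)) -> forall c, P c.
Proof. by move=> PX c; rewrite -(ireprK c). Qed.

Definition iadd (c d : isoclass) : isoclass :=
  iclass (sum_biset (irepr c) (irepr d)).

Lemma iaddE X Y : iadd (iclass X) (iclass Y) = iclass (sum_biset X Y).
Proof. by apply/iclassP/sum_bisetS; apply: irepr_iso. Qed.

Lemma iaddA : associative iadd.
Proof.
elim/iclassW=> X; elim/iclassW=> Y; elim/iclassW=> Z.
by rewrite !iaddE; apply/iclassP/sum_bisetA.
Qed.

Lemma iaddC : commutative iadd.
Proof.
elim/iclassW=> X; elim/iclassW=> Y.
by rewrite !iaddE; apply/iclassP/sum_bisetC.
Qed.

Lemma iadd0 : left_id (iclass empty_biset) iadd.
Proof. by elim/iclassW=> X; rewrite iaddE; apply/iclassP/sum_biset0. Qed.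

HB.instance Definition _ := GRing.isNmodule.Build isoclass iaddA iaddC iadd0.

Lemma iclassD X Y : (iclass (sum_biset X Y) = iclass X + iclass Y)%R.
Proof. by rewrite -iaddE. Qed.

End Biset.

Section Grothendieck.
Local Open Scope ring_scope.
Variable M : nmodType.

Definition groth_eq : rel (M * M) :=
  fun p q => `[< exists e, p.1 + q.2 + e = q.1 + p.2 + e >].

Lemma groth_eq_refl : reflexive groth_eq.
Proof. by move=> p; apply/asboolP; exists 0. Qed.

Lemma groth_eq_sym : symmetric groth_eq.
Proof. by move=> p q; apply/asboolP/asboolP => -[e pq]; exists e. Qed.

Lemma groth_eq_trans : transitive groth_eq.
Proof.
move=> q p r /asboolP[e pq] /asboolP[f qr]; apply/asboolP.
exists (q.1 + q.2 + e + f).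
transitivity ((p.1 + q.2 + e) + (q.1 + r.2 + f)).
  by rewrite (AC (2*4) ((1*4*5)*(3*2*6))).
by rewrite pq qr (AC ((1*1*1)*(1*1*1)) (4*2*(1*5*3*6)))/=.
Qed.

Canonical groth_equiv :=
  EquivRel groth_eq groth_eq_refl groth_eq_sym groth_eq_trans.

Definition groth := {eq_quot groth_eq}.
HB.instance Definition _ := Choice.on groth.
HB.instance Definition _ := Quotient.on groth.
HB.instance Definition _ := EqQuotient.on groth.

(* the formal difference [p.1 - p.2] *)
Definition gpair (p : M * M) : groth := (\pi_groth p)%qT.

Lemma gpairP p q :
  gpair p = gpair q <-> exists e, p.1 + q.2 + e = q.1 + p.2 + e.
Proof. by split=> [/eqquotP/asboolP | pq]; last exact/eqquotP/asboolP. Qed.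

Lemma gpairK x : gpair (repr x) = x. Proof. exact: reprK. Qed.

Lemma gpairW (P : groth -> Prop) : (forall p, P (gpair p)) -> forall x, P x.
Proof. by move=> Pp x; rewrite -(gpairK x). Qed.

Definition gadd (x y : groth) : groth :=
  gpair ((repr x).1 + (repr y).1, (repr x).2 + (repr y).2).
Definition gopp (x : groth) : groth := gpair ((repr x).2, (repr x).1).

Lemma gaddE p q : gadd (gpair p) (gpair q) = gpair (p.1 + q.1, p.2 + q.2).
Proof.
have /gpairP[e He] := gpairK (gpair p); have /gpairP[f Hf] := gpairK (gpair q).
apply/gpairP; exists (e + f) => /=.
move: He Hf; set p' := repr _; set q' := repr _ => He Hf.
transitivity ((p'.1 + p.2 + e) + (q'.1 + q.2 + f)).
  by rewrite (AC ((2*2)*2) ((1*3*5)*(2*4*6))).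
by rewrite He Hf (AC ((1*1*1)*(1*1*1)) (((1*4)*(2*5))*(3*6))).
Qed.

Lemma goppE p : gopp (gpair p) = gpair (p.2, p.1).
Proof.
have /gpairP[e He] := gpairK (gpair p).
apply/gpairP; exists e => /=.
by rewrite [_ + p.1]addrC -He [p.2 + _]addrC.
Qed.

Lemma gaddA : associative gadd.
Proof.
elim/gpairW=> p; elim/gpairW=> q; elim/gpairW=> r.
by rewrite !gaddE /= !addrA.
Qed.

Lemma gaddC : commutative gadd.
Proof.
elim/gpairW=> p; elim/gpairW=> q.
by rewrite !gaddE addrC [p.2 + _]addrC.
Qed.

Lemma gadd0 : left_id (gpair (0, 0)) gadd.
Proof. by elim/gpairW=> -[a b]; rewrite !gaddE /= !add0r. Qed.

Lemma gaddN : left_inverse (gpair (0, 0)) gopp gadd.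
Proof.
elim/gpairW=> -[a b]; rewrite goppE gaddE /=.
by apply/gpairP; exists 0 => /=; rewrite !addr0 add0r addrC.
Qed.

HB.instance Definition _ := GRing.isZmodule.Build groth gaddA gaddC gadd0 gaddN.

Definition gclass (a : M) : groth := gpair (a, 0).

Lemma gclassP a b : gclass a = gclass b <-> exists e, a + e = b + e.
Proof. by rewrite gpairP /= !addr0. Qed.

Lemma gclassD a b : gclass (a + b) = gclass a + gclass b.
Proof. by rewrite [RHS]gaddE /= addr0. Qed.

Lemma gclass0 : gclass 0 = 0. Proof. by []. Qed.

Lemma gpairE p : gpair p = gclass p.1 - gclass p.2.
Proof.
rewrite [- _]goppE [RHS]gaddE /=.
by apply/gpairP; exists 0; rewrite /= !addr0 add0r.
Qed.

Lemma groth_ind (P : groth -> Prop) :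
  (forall a, P (gclass a)) -> (forall x y, P x -> P y -> P (x - y)) ->
  forall x, P x.
Proof. by move=> Pc PB; elim/gpairW=> p; rewrite gpairE; apply: PB. Qed.

Section Lift.
Variables (V : zmodType) (f : M -> V).

Definition glift (x : groth) : V := f (repr x).1 - f (repr x).2.

Hypothesis fD : {morph f : a b / a + b}.

Lemma gliftE p : glift (gpair p) = f p.1 - f p.2.
Proof.
have /gpairP[e /(congr1 f)] := gpairK (gpair p).
rewrite !fD => /addIr E; apply/eqP.
by rewrite /glift subr_eq addrAC eq_sym subr_eq eq_sym E.
Qed.

Lemma gliftc a : glift (gclass a) = f a.
Proof.
rewrite gliftE /= -[X in f X - _]addr0 fD addrK //.
Qed.

Lemma gliftB : {morph glift : x y / x - y}.
Proof.
elim/gpairW=> p; elim/gpairW=> q.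
rewrite [- _]goppE [_ + _]gaddE !gliftE /= !fD opprD opprB.
by rewrite (AC (2*2) ((1*3)*(2*4))).
Qed.
End Lift.

End Grothendieck.

Section BiLift.
Local Open Scope ring_scope.
Variables (M N : nmodType) (V : zmodType) (f : M -> N -> V).

Definition glift2 (x : groth M) (y : groth N) : V :=
  glift (fun a => glift (f a) y) x.

Hypothesis fDl : forall b, {morph f^~ b : a a' / a + a'}.
Hypothesis fDr : forall a, {morph f a : b b' / b + b'}.

Let glift_fD y : {morph (fun a => glift (f a) y) : a a' / a + a'}.
Proof.
by move=> a a'; rewrite /glift !fDl opprD (AC (2*2) ((1*3)*(2*4))).
Qed.

Lemma glift2c a b : glift2 (gclass a) (gclass b) = f a b.
Proof. by rewrite /glift2 gliftc ?gliftc. Qed.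

Lemma glift2Bl x x' y : glift2 (x - x') y = glift2 x y - glift2 x' y.
Proof. exact: gliftB. Qed.

Lemma glift2Br x y y' : glift2 x (y - y') = glift2 x y - glift2 x y'.
Proof.
rewrite /glift2 {1 3 5}/glift !gliftB // !opprB.
by rewrite (AC (2*2) ((1*4)*(3*2))).
Qed.
End BiLift.

Definition burnside (gT hT : finGroupType) := groth (isoclass gT hT).
HB.instance Definition _ gT hT := GRing.Zmodule.on (burnside gT hT).

Definition bclass gT hT (X : biset gT hT) : burnside gT hT :=
  gclass (iclass X).

Section BurnsideTheory.
Local Open Scope ring_scope.
Variables gT hT : finGroupType.

Lemma bclassP (X Y : biset gT hT) : bclass X = bclass Y <->
  exists Z, biset_iso (sum_biset X Z) (sum_biset Y Z).
Proof.
rewrite gclassP; split=> [[c] | [Z /iclassP]].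
- by elim/iclassW: c => Z; rewrite -!iclassD => /iclassP; exists Z.
- by rewrite !iclassD; exists (iclass Z).
Qed.

Lemma bclass_iso (X Y : biset gT hT) : biset_iso X Y -> bclass X = bclass Y.
Proof. by move/iclassP; rewrite /bclass => ->. Qed.

Lemma bclassD (X Y : biset gT hT) :
  bclass (sum_biset X Y) = bclass X + bclass Y.
Proof. by rewrite /bclass iclassD gclassD. Qed.

Lemma burnside_ind (P : burnside gT hT -> Prop) :
  (forall X, P (bclass X)) -> (forall x y, P x -> P y -> P (x - y)) ->
  forall x, P x.
Proof. by move=> PX; apply: groth_ind; elim/iclassW. Qed.
End BurnsideTheory.

Section TensorDef.
Variables gT hT kT : finGroupType.
Variables (X : biset gT hT) (Y : biset hT kT).

Definition horbit (p : X * Y) : {set X * Y} :=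
  [set (ract X p.1 h^-1, lact Y h p.2) | h in [set: hT]]%SET.

Lemma mem_horbit p q : reflect
  (exists h, q = (ract X p.1 h^-1, lact Y h p.2)) (q \in horbit p).
Proof.
by apply: (iffP imsetP) => [[h _ ->] | [h ->]]; exists h; rewrite ?inE.
Qed.

Lemma horbit_eqP p q : reflect
  (exists h, q = (ract X p.1 h^-1, lact Y h p.2)) (horbit p == horbit q).
Proof.
have refl r : r \in horbit r.
  apply/mem_horbit; exists 1; rewrite invg1 ract1 lact1.
  by case: r.
apply: (iffP eqP) => [E | [h ->]].
  by apply/mem_horbit; rewrite E.
apply/setP=> r; apply/mem_horbit/mem_horbit => /= -[k ->].
- exists (k * h^-1); rewrite -!ractM -!lactM invMg invgK.
  by rewrite mulgA mulVg mul1g mulgKV.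
- by exists (k * h); rewrite -!ractM -!lactM invMg.
Qed.

Definition is_horbit (S : {set X * Y}) := [exists p, S == horbit p].

Record tensor_car := TensorCar { tset : {set X * Y}; _ : is_horbit tset }.
HB.instance Definition _ := [isSub for tset].
HB.instance Definition _ := [Finite of tensor_car by <:].

Lemma is_horbitP p : is_horbit (horbit p).
Proof. by apply/existsP; exists p. Qed.

Definition tclass p : tensor_car := TensorCar (is_horbitP p).

Lemma tclassP p q : tclass p = tclass q <->
  exists h, q = (ract X p.1 h^-1, lact Y h p.2).
Proof.
split=> [/(congr1 val)/= /eqP/horbit_eqP // | pq].
by apply/val_inj/eqP/horbit_eqP.
Qed.

Lemma tclass_bal x h y : tclass (ract X x h, y) = tclass (x, lact Y h y).
Proof. by apply/tclassP; exists h => /=; rewrite -ractM mulgV ract1. Qed.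

Lemma is_horbit_l g (S : tensor_car) :
  is_horbit [set (lact X g p.1, p.2) | p in val S]%SET.
Proof.
case: S => S /= /existsP[[x y] /eqP->]; apply/existsP; exists (lact X g x, y).
apply/eqP/setP=> r; apply/imsetP/mem_horbit => /=.
- by case=> _ /mem_horbit[h ->] ->; exists h; rewrite /= lractA.
- case=> h ->; exists (ract X x h^-1, lact Y h y) => /=; last by rewrite lractA.
  by apply/mem_horbit; exists h.
Qed.

Lemma is_horbit_r k (S : tensor_car) :
  is_horbit [set (p.1, ract Y p.2 k) | p in val S]%SET.
Proof.
case: S => S /= /existsP[[x y] /eqP->]; apply/existsP; exists (x, ract Y y k).
apply/eqP/setP=> r; apply/imsetP/mem_horbit => /=.
- by case=> _ /mem_horbit[h ->] ->; exists h; rewrite /= lractA.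
- case=> h ->; exists (ract X x h^-1, lact Y h y) => /=; last by rewrite lractA.
  by apply/mem_horbit; exists h.
Qed.

Definition tensor_lact g S : tensor_car := TensorCar (is_horbit_l g S).
Definition tensor_ract S k : tensor_car := TensorCar (is_horbit_r k S).

Lemma tclassW (P : tensor_car -> Prop) :
  (forall x y, P (tclass (x, y))) -> forall S, P S.
Proof.
move=> PS S; have /existsP[[x y] /eqP E] := valP S.
by have -> : S = tclass (x, y) by apply: val_inj.
Qed.

Lemma tensor_lactE g x y :
  tensor_lact g (tclass (x, y)) = tclass (lact X g x, y).
Proof.
apply/val_inj/setP=> r; apply/imsetP/mem_horbit => /=.
- by case=> _ /mem_horbit[h ->] ->; exists h; rewrite /= lractA.
- case=> h ->; exists (ract X x h^-1, lact Y h y) => /=; last by rewrite lractA.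
  by apply/mem_horbit; exists h.
Qed.

Lemma tensor_ractE x y k :
  tensor_ract (tclass (x, y)) k = tclass (x, ract Y y k).
Proof.
apply/val_inj/setP=> r; apply/imsetP/mem_horbit => /=.
- by case=> _ /mem_horbit[h ->] ->; exists h; rewrite /= lractA.
- case=> h ->; exists (ract X x h^-1, lact Y h y) => /=; last by rewrite lractA.
  by apply/mem_horbit; exists h.
Qed.

Definition tensor_on : biset_on gT kT tensor_car.
Proof.
exists tensor_lact tensor_ract.
- by elim/tclassW=> x y; rewrite tensor_lactE lact1.
- by move=> g g'; elim/tclassW=> x y; rewrite !tensor_lactE lactM.
- by elim/tclassW=> x y; rewrite tensor_ractE ract1.
- by elim/tclassW=> x y h h'; rewrite !tensor_ractE ractM.
- by move=> g; elim/tclassW=> x y h; rewrite !(tensor_ractE, tensor_lactE).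
Defined.

Definition tensor : biset gT kT := Biset tensor_on.

Lemma tensor_lE g x y : lact tensor g (tclass (x, y)) = tclass (lact X g x, y).
Proof. exact: tensor_lactE. Qed.
Lemma tensor_rE x y k : ract tensor (tclass (x, y)) k = tclass (x, ract Y y k).
Proof. exact: tensor_ractE. Qed.

Section Factor.
Variables (T : Type) (f : X -> Y -> T).
Hypothesis fbal : forall x h y, f (ract X x h) y = f x (lact Y h y).

Lemma tfactor_ex (S : tensor_car) :
  exists t, forall x y, S = tclass (x, y) -> t = f x y.
Proof.
elim/tclassW: S => x y; exists (f x y) => x' y' /tclassP[h [-> ->]] /=.
by rewrite fbal -lactM mulVg lact1.
Qed.

Definition tfactor (S : tensor_car) : T := projT1 (cid (tfactor_ex S)).

Lemma tfactorE x y : tfactor (tclass (x, y)) = f x y.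
Proof. by rewrite /tfactor; case: cid => t /= /(_ _ _ erefl). Qed.
End Factor.

End TensorDef.

Section TensorTheory.
Variables gT hT kT : finGroupType.

Lemma tensorS (X X' : biset gT hT) (Y Y' : biset hT kT) :
  biset_iso X X' -> biset_iso Y Y' -> biset_iso (tensor X Y) (tensor X' Y').
Proof.
case=> f [[f' fK f'K] fl fr] [k [[k' kK k'K] kl kr]].
have f'l g x : f' (lact X' g x) = lact X g (f' x).
  by apply: (can_inj fK); rewrite fl !f'K.
have f'r x h : f' (ract X' x h) = ract X (f' x) h.
  by apply: (can_inj fK); rewrite fr !f'K.
have k'l g x : k' (lact Y' g x) = lact Y g (k' x).
  by apply: (can_inj kK); rewrite kl !k'K.
have k'r x h : k' (ract Y' x h) = ract Y (k' x) h.
  by apply: (can_inj kK); rewrite kr !k'K.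
pose F x y := tclass (X := X') (Y := Y') (f x, k y).
pose F' x y := tclass (X := X) (Y := Y) (f' x, k' y).
have Fb x h y : F (ract X x h) y = F x (lact Y h y).
  by rewrite /F fr kl tclass_bal.
have F'b x h y : F' (ract X' x h) y = F' x (lact Y' h y).
  by rewrite /F' f'r k'l tclass_bal.
exists (tfactor Fb); split.
- exists (tfactor F'b); elim/tclassW=> x y.
  + by rewrite tfactorE tfactorE /F' fK kK.
  + by rewrite tfactorE tfactorE /F f'K k'K.
- by move=> g; elim/tclassW=> x y; rewrite tensor_lE !tfactorE /F tensor_lE fl.
- by elim/tclassW=> x y h; rewrite tensor_rE !tfactorE /F tensor_rE kr.
Qed.

Lemma tensorDl (X X' : biset gT hT) (Y : biset hT kT) :
  biset_iso (tensor (sum_biset X X') Y)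
            (sum_biset (tensor X Y) (tensor X' Y)).
Proof.
pose F (u : sum_biset X X') y : sum_biset (tensor X Y) (tensor X' Y) :=
  match u with inl x => inl (tclass (x, y)) | inr x => inr (tclass (x, y)) end.
have Fb x h y : F (ract (sum_biset X X') x h) y = F x (lact Y h y).
  by case: x => x; rewrite /F /= tclass_bal.
pose T := tensor (sum_biset X X') Y.
pose L x y : T := tclass (inl x : sum_biset X X', y).
pose R x y : T := tclass (inr x : sum_biset X X', y).
have Lb x h y : L (ract X x h) y = L x (lact Y h y).
  by rewrite /L -tclass_bal.
have Rb x h y : R (ract X' x h) y = R x (lact Y h y).
  by rewrite /R -tclass_bal.
exists (tfactor Fb); split.
- exists (fun u => match u with inl s => tfactor Lb s | inr s => tfactor Rb s end).
  + by elim/tclassW=> -[] x y; rewrite tfactorE /= tfactorE.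
  + by case; elim/tclassW=> x y; rewrite !tfactorE.
- by move=> g; elim/tclassW=> -[] x y;
     rewrite tensor_lE !tfactorE /= -tensor_lE.
- by elim/tclassW=> -[] x y h; rewrite tensor_rE !tfactorE /= -tensor_rE.
Qed.

Lemma tensorDr (X : biset gT hT) (Y Y' : biset hT kT) :
  biset_iso (tensor X (sum_biset Y Y'))
            (sum_biset (tensor X Y) (tensor X Y')).
Proof.
pose F x (u : sum_biset Y Y') : sum_biset (tensor X Y) (tensor X Y') :=
  match u with inl y => inl (tclass (x, y)) | inr y => inr (tclass (x, y)) end.
have Fb x h y : F (ract X x h) y = F x (lact (sum_biset Y Y') h y).
  by case: y => y; rewrite /F /= tclass_bal.
pose T := tensor X (sum_biset Y Y').
pose L x y : T := tclass (x, inl y : sum_biset Y Y').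
pose R x y : T := tclass (x, inr y : sum_biset Y Y').
have Lb x h y : L (ract X x h) y = L x (lact Y h y).
  by rewrite /L tclass_bal.
have Rb x h y : R (ract X x h) y = R x (lact Y' h y).
  by rewrite /R tclass_bal.
exists (tfactor Fb); split.
- exists (fun u => match u with inl s => tfactor Lb s | inr s => tfactor Rb s end).
  + by elim/tclassW=> x [] y; rewrite tfactorE /= tfactorE.
  + by case; elim/tclassW=> x y; rewrite !tfactorE.
- by move=> g; elim/tclassW=> x [] y;
     rewrite tensor_lE !tfactorE /= -tensor_lE.
- by elim/tclassW=> x [] y h; rewrite tensor_rE !tfactorE /= -tensor_rE.
Qed.

Definition opp_biset_on (X : biset gT hT) : biset_on hT gT X.
Proof.
exists (fun h x => ract X x h^-1) (fun x g => lact X g^-1 x).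
- by move=> x; rewrite invg1 ract1.
- by move=> h h' x; rewrite invMg ractM.
- by move=> x; rewrite invg1 lact1.
- by move=> x g g'; rewrite invMg lactM.
- by move=> h x g; rewrite lractA.
Defined.

Definition opp_biset X : biset hT gT := Biset (opp_biset_on X).

Lemma opp_bisetS (X Y : biset gT hT) :
  biset_iso X Y -> biset_iso (opp_biset X) (opp_biset Y).
Proof.
by case=> f [bf fl fr]; exists f; split=> // [g x | x h] /=; rewrite ?fl ?fr.
Qed.

Lemma opp_bisetD (X Y : biset gT hT) : biset_iso
  (opp_biset (sum_biset X Y)) (sum_biset (opp_biset X) (opp_biset Y)).
Proof. by exists id; split; [exists id | move=> g [] | move=> []]. Qed.

End TensorTheory.

Lemma tensorA gT hT kT lT
    (X : biset gT hT) (Y : biset hT kT) (Z : biset kT lT) :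
  biset_iso (tensor X (tensor Y Z)) (tensor (tensor X Y) Z).
Proof.
pose T1 := tensor X (tensor Y Z); pose T2 := tensor (tensor X Y) Z.
pose f x y z : T2 := tclass (tclass (x, y) : tensor X Y, z).
have fb x y k z : f x (ract Y y k) z = f x y (lact Z k z).
  by rewrite /f -tensor_rE tclass_bal.
pose F x (s : tensor Y Z) : T2 := tfactor (fb x) s.
have Fb x h s : F (ract X x h) s = F x (lact (tensor Y Z) h s).
  elim/tclassW: s => y z; rewrite tensor_lE /F tfactorE tfactorE.
  by rewrite /f tclass_bal.
pose k z x y : T1 := tclass (x, tclass (y, z) : tensor Y Z).
have kb z x h y : k z (ract X x h) y = k z x (lact Y h y).
  by rewrite /k tclass_bal tensor_lE.
pose K (s : tensor X Y) z : T1 := tfactor (kb z) s.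
have Kb s h z : K (ract (tensor X Y) s h) z = K s (lact Z h z).
  elim/tclassW: s => x y; rewrite tensor_rE /K tfactorE tfactorE.
  by rewrite /k tclass_bal.
exists (tfactor Fb); split.
- exists (tfactor Kb).
  + elim/tclassW=> x s; rewrite tfactorE; elim/tclassW: s => y z.
    by rewrite /F tfactorE /f tfactorE /K tfactorE.
  + elim/tclassW=> s z; rewrite tfactorE; elim/tclassW: s => x y.
    by rewrite /K tfactorE /k tfactorE /F tfactorE.
- move=> g; elim/tclassW=> x s; rewrite tensor_lE !tfactorE.
  elim/tclassW: s => y z.
  by rewrite /F !tfactorE /f tensor_lE tensor_lE.
- elim/tclassW=> x s h; rewrite tensor_rE !tfactorE.
  elim/tclassW: s => y z.
  by rewrite tensor_rE /F !tfactorE /f tensor_rE.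
Qed.

Lemma tensor_opp gT hT kT (X : biset gT hT) (Y : biset hT kT) :
  biset_iso (opp_biset (tensor X Y)) (tensor (opp_biset Y) (opp_biset X)).
Proof.
pose F x y := tclass (X := opp_biset Y) (Y := opp_biset X) (y, x).
have Fb x h y : F (ract X x h) y = F x (lact Y h y).
  rewrite /F -{1}[h]invgK.
  by rewrite -[ract X x _]/(lact (opp_biset X) h^-1 x) -tclass_bal /= invgK.
pose K (y : opp_biset Y) (x : opp_biset X) := tclass (X := X) (Y := Y) (x, y).
have Kb y h x : K (ract (opp_biset Y) y h) x = K y (lact (opp_biset X) h x).
  by rewrite /K /= -tclass_bal.
exists (tfactor Fb); split.
- exists (tfactor Kb); elim/tclassW=> x y.
  + by rewrite tfactorE /F tfactorE.
  + by rewrite tfactorE /K tfactorE.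
- move=> g; elim/tclassW=> x y.
  rewrite [X in tfactor Fb X]tensor_rE !tfactorE /F.
  by rewrite tensor_lE.
- elim/tclassW=> x y g.
  rewrite [X in tfactor Fb X]tensor_lE !tfactorE /F.
  by rewrite tensor_rE.
Qed.

Section Regular.
Variable gT : finGroupType.

Definition id_biset_on : biset_on gT gT gT.
Proof.
exists (fun g x => g * x) (fun x g => x * g).
- exact: mul1g.
- by move=> g g' x; rewrite mulgA.
- exact: mulg1.
- by move=> x g g'; rewrite mulgA.
- by move=> g x h; rewrite mulgA.
Defined.

Definition id_biset : biset gT gT := Biset id_biset_on.

Lemma id_biset_opp : biset_iso (opp_biset id_biset) id_biset.
Proof.
exists (fun x : gT => x^-1); split; first by exists invg => x; rewrite /= invgK.
- by move=> g x /=; rewrite invMg invgK.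
- by move=> x g /=; rewrite invMg invgK.
Qed.
End Regular.

Lemma tensor_idl gT hT (X : biset gT hT) :
  biset_iso (tensor (id_biset gT) X) X.
Proof.
pose F (g : id_biset gT) x := lact X g x.
have Fb g h x : F (ract (id_biset gT) g h) x = F g (lact X h x).
  by rewrite /F /= lactM.
exists (tfactor Fb); split.
- exists (fun x => tclass (1 : id_biset gT, x)).
  + elim/tclassW=> g x; rewrite tfactorE /F -tclass_bal /=.
    by rewrite mul1g.
  + by move=> x; rewrite tfactorE /F lact1.
- by move=> g; elim/tclassW=> g' x; rewrite tensor_lE !tfactorE /F /= lactM.
- by elim/tclassW=> g' x h; rewrite tensor_rE !tfactorE /F lractA.
Qed.

Lemma tensor_idr gT hT (X : biset gT hT) :
  biset_iso (tensor X (id_biset hT)) X.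
Proof.
pose F x (g : id_biset hT) := ract X x g.
have Fb x h g : F (ract X x h) g = F x (lact (id_biset hT) h g).
  by rewrite /F /= ractM.
exists (tfactor Fb); split.
- exists (fun x => tclass (x, 1 : id_biset hT)).
  + elim/tclassW=> x g; rewrite tfactorE /F tclass_bal /=.
    by rewrite mulg1.
  + by move=> x; rewrite tfactorE /F ract1.
- by move=> g; elim/tclassW=> x g'; rewrite tensor_lE !tfactorE /F lractA.
- by elim/tclassW=> x g' h; rewrite tensor_rE !tfactorE /F /= ractM.
Qed.

HB.lock Definition bcomp (gT hT kT : finGroupType)
    (x : burnside gT hT) (y : burnside hT kT) : burnside gT kT :=
  glift2 (fun c d => bclass (tensor (irepr c) (irepr d))) x y.

HB.lock Definition bopp (gT hT : finGroupType)
    (x : burnside gT hT) : burnside hT gT :=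
  glift (fun c => bclass (opp_biset (irepr c))) x.

Section Composition.
Local Open Scope ring_scope.
Variables gT hT kT : finGroupType.

Let f (c : isoclass gT hT) (d : isoclass hT kT) : burnside gT kT :=
  bclass (tensor (irepr c) (irepr d)).

Let fE X Y : f (iclass X) (iclass Y) = bclass (tensor X Y).
Proof. by apply/bclass_iso/tensorS; apply: irepr_iso. Qed.

Let fDl d : {morph f^~ d : c c' / c + c'}.
Proof.
elim/iclassW: d => Y; elim/iclassW=> X; elim/iclassW=> X'.
rewrite -iclassD !fE -bclassD; exact/bclass_iso/tensorDl.
Qed.

Let fDr c : {morph f c : d d' / d + d'}.
Proof.
elim/iclassW: c => X; elim/iclassW=> Y; elim/iclassW=> Y'.
rewrite -iclassD !fE -bclassD; exact/bclass_iso/tensorDr.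
Qed.

Lemma bcompE (X : biset gT hT) (Y : biset hT kT) : bcomp (bclass X) (bclass Y) = bclass (tensor X Y).
Proof. by rewrite bcomp.unlock glift2c // [LHS]fE. Qed.

Lemma bcompBl (x x' : burnside gT hT) (y : burnside hT kT) :
  bcomp (x - x') y = bcomp x y - bcomp x' y.
Proof. rewrite bcomp.unlock; exact: glift2Bl. Qed.

Lemma bcompBr (x : burnside gT hT) (y y' : burnside hT kT) :
  bcomp x (y - y') = bcomp x y - bcomp x y'.
Proof. rewrite bcomp.unlock; exact: glift2Br. Qed.

Lemma bcomp0l (y : burnside hT kT) : bcomp (0 : burnside gT hT) y = 0.
Proof. by rewrite -(subrr 0) bcompBl subrr. Qed.
Lemma bcomp0r (x : burnside gT hT) : bcomp x (0 : burnside hT kT) = 0.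
Proof. by rewrite -(subrr 0) bcompBr subrr. Qed.
Lemma bcompNl (x : burnside gT hT) (y : burnside hT kT) :
  bcomp (- x) y = - bcomp x y.
Proof. by rewrite -[- x]sub0r bcompBl bcomp0l sub0r. Qed.
Lemma bcompNr (x : burnside gT hT) (y : burnside hT kT) :
  bcomp x (- y) = - bcomp x y.
Proof. by rewrite -[- y]sub0r bcompBr bcomp0r sub0r. Qed.
Lemma bcompDl (x x' : burnside gT hT) (y : burnside hT kT) :
  bcomp (x + x') y = bcomp x y + bcomp x' y.
Proof. by rewrite -{1}[x']opprK bcompBl bcompNl opprK. Qed.
Lemma bcompDr (x : burnside gT hT) (y y' : burnside hT kT) :
  bcomp x (y + y') = bcomp x y + bcomp x y'.
Proof. by rewrite -{1}[y']opprK bcompBr bcompNr opprK. Qed.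

Let oD : {morph (fun c : isoclass gT hT =>
  bclass (opp_biset (irepr c))) : c d / c + d}.
Proof.
elim/iclassW=> X; elim/iclassW=> Y.
rewrite -iclassD -bclassD; apply/bclass_iso.
apply: biset_iso_trans (opp_bisetS (irepr_iso _)) _.
apply: biset_iso_trans (opp_bisetD _ _) _.
by apply: sum_bisetS; apply/opp_bisetS/biset_iso_sym/irepr_iso.
Qed.

Lemma boppE (X : biset gT hT) : bopp (bclass X) = bclass (opp_biset X).
Proof.
rewrite bopp.unlock gliftc; last exact: oD.
exact/bclass_iso/opp_bisetS/irepr_iso.
Qed.

Lemma boppB (x y : burnside gT hT) : bopp (x - y) = bopp x - bopp y.
Proof. rewrite bopp.unlock; exact: gliftB. Qed.
Lemma bopp0 : bopp (0 : burnside gT hT) = 0. Proof. by rewrite -(subrr 0) boppB subrr. Qed.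
Lemma boppN (x : burnside gT hT) : bopp (- x) = - bopp x.
Proof. by rewrite -[- x]sub0r boppB bopp0 sub0r. Qed.
Lemma boppD (x y : burnside gT hT) : bopp (x + y) = bopp x + bopp y.
Proof. by rewrite -{1}[y]opprK boppB boppN opprK. Qed.
End Composition.

Lemma bcompA gT hT kT lT (x : burnside gT hT) (y : burnside hT kT)
  (z : burnside kT lT) : bcomp x (bcomp y z) = bcomp (bcomp x y) z.
Proof.
elim/burnside_ind: x => [X|x x' IH IH']; last by rewrite !bcompBl IH IH'.
elim/burnside_ind: y => [Y|y y' IH IH'].
  elim/burnside_ind: z => [Z|z z' IH IH']; last by rewrite !bcompBr IH IH'.
  by rewrite !bcompE; apply/bclass_iso/tensorA.
by rewrite bcompBl !bcompBr bcompBl IH IH'.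
Qed.

Lemma bopp_comp gT hT kT (x : burnside gT hT) (y : burnside hT kT) :
  bopp (bcomp x y) = bcomp (bopp y) (bopp x).
Proof.
elim/burnside_ind: x => [X|x x' IH IH'].
  elim/burnside_ind: y => [Y|y y' IH IH'].
    by rewrite !(bcompE, boppE); apply/bclass_iso/tensor_opp.
  by rewrite !(boppB, bcompBr, bcompBl) IH IH'.
by rewrite !(boppB, bcompBr, bcompBl) IH IH'.
Qed.

Lemma boppK gT hT (x : burnside gT hT) : bopp (bopp x) = x.
Proof.
elim/burnside_ind: x => [X|x y IHx IHy]; last by rewrite !boppB IHx IHy.
rewrite !boppE; apply/bclass_iso; exists id.
by split; [exists id | move=> g x /=; rewrite invgK | move=> x h /=; rewrite invgK].
Qed.

Section BurnsideRing.
Local Open Scope ring_scope.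
Variable gT : finGroupType.

Definition bid : burnside gT gT := bclass (id_biset gT).

Lemma bid_opp : bopp bid = bid.
Proof. by rewrite boppE; apply/bclass_iso/id_biset_opp. Qed.
End BurnsideRing.

Lemma bcomp1l gT hT (x : burnside gT hT) : bcomp (bid gT) x = x.
Proof.
elim/burnside_ind: x => [X|x y IHx IHy]; last by rewrite bcompBr IHx IHy.
by rewrite bcompE; apply/bclass_iso/tensor_idl.
Qed.

Lemma bcomp1r gT hT (x : burnside gT hT) : bcomp x (bid hT) = x.
Proof.
elim/burnside_ind: x => [X|x y IHx IHy]; last by rewrite bcompBl IHx IHy.
by rewrite bcompE; apply/bclass_iso/tensor_idr.
Qed.

HB.instance Definition _ (gT : finGroupType) :=
  GRing.Zmodule_isPzRing.Build (burnside gT gT)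
    (@bcompA gT gT gT gT) (@bcomp1l gT gT) (@bcomp1r gT gT)
    (@bcompDl gT gT gT) (@bcompDr gT gT gT).

Section OrthUnits.
Local Open Scope ring_scope.
Variable gT : finGroupType.
Implicit Types u v : burnside gT gT.

(* The two equations make [u] invertible, with inverse [bopp u]. *)
Definition orthogonal u := (u * bopp u == 1) && (bopp u * u == 1).

Record orthunit := OrthUnit { ouval :> burnside gT gT; _ : orthogonal ouval }.
HB.instance Definition _ := [isSub for ouval].
HB.instance Definition _ := [Choice of orthunit by <:].

Lemma bopp1 : bopp 1 = 1 :> burnside gT gT. Proof. exact: bid_opp. Qed.
Lemma boppM u v : bopp (u * v) = bopp v * bopp u. Proof. exact: bopp_comp. Qed.

Lemma orthogonal1 : orthogonal 1.
Proof. by rewrite /orthogonal bopp1 mulr1 eqxx. Qed.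

Lemma orthogonalM u v : orthogonal u -> orthogonal v -> orthogonal (u * v).
Proof.
case/andP=> /eqP u1 /eqP u2 /andP[/eqP v1 /eqP v2].
rewrite /orthogonal boppM; apply/andP; split; apply/eqP.
- by rewrite mulrA -[u * v * _]mulrA v1 mulr1.
- by rewrite mulrA -[_ * bopp u * u]mulrA u2 mulr1.
Qed.

Lemma orthogonalV u : orthogonal u -> orthogonal (bopp u).
Proof. by rewrite /orthogonal boppK andbC. Qed.

Lemma orthogonalN u : orthogonal u -> orthogonal (- u).
Proof. by rewrite /orthogonal boppN !mulrNN. Qed.

Definition ou1 := OrthUnit orthogonal1.
Definition ouM (u v : orthunit) := OrthUnit (orthogonalM (valP u) (valP v)).
Definition ouV (u : orthunit) := OrthUnit (orthogonalV (valP u)).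
Definition ouN (u : orthunit) := OrthUnit (orthogonalN (valP u)).

Lemma ouMA : associative ouM.
Proof. by move=> u v w; apply/val_inj/mulrA. Qed.
Lemma ou1M : left_id ou1 ouM. Proof. by move=> u; apply/val_inj/mul1r. Qed.
Lemma ouM1 : right_id ou1 ouM. Proof. by move=> u; apply/val_inj/mulr1. Qed.
Lemma ouVM : left_inverse ou1 ouV ouM.
Proof. by move=> u; apply/val_inj/eqP; case/andP: (valP u). Qed.
Lemma ouMV : right_inverse ou1 ouV ouM.
Proof. by move=> u; apply/val_inj/eqP; case/andP: (valP u). Qed.

HB.instance Definition _ := isGroup.Build orthunit ouMA ou1M ouM1 ouVM ouMV.
End OrthUnits.

(* For [N] normal in the whole of [gT], the type [coset_of N] is G/N. *)
Section DBInf.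
Local Open Scope ring_scope.
Variables (gT : finGroupType) (N : {group gT}).
Hypothesis nN : N <| [set: gT]%G.

Let cosetM (g h : gT) : coset N (g * h)%g = (coset N g * coset N h)%g.
Proof.
have nNG x : x \in 'N(N)%g by apply: (fintype.subsetP (normal_norm nN)); rewrite inE.
exact: morphM.
Qed.

Let cosetV (g : gT) : coset N g^-1%g = (coset N g)^-1%g.
Proof.
have nNG : g \in 'N(N)%g by apply: (fintype.subsetP (normal_norm nN)); rewrite inE.
exact: morphV.
Qed.

Definition inf_biset_on : biset_on gT (coset_of N) (coset_of N).
Proof.
exists (fun g c => coset N g * c)%g (fun c d => c * d)%g.
- by move=> c; rewrite morph1 mul1g.
- by move=> g h c; rewrite cosetM mulgA.
- exact: mulg1.
- by move=> c d e; rewrite mulgA.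
- by move=> g c d; rewrite mulgA.
Defined.

Definition def_biset_on : biset_on (coset_of N) gT (coset_of N).
Proof.
exists (fun d c => d * c)%g (fun c g => c * coset N g)%g.
- exact: mul1g.
- by move=> c d e; rewrite mulgA.
- by move=> c; rewrite morph1 mulg1.
- by move=> c g h; rewrite cosetM mulgA.
- by move=> g c d; rewrite mulgA.
Defined.

Definition inf_biset : biset gT (coset_of N) := Biset inf_biset_on.
Definition def_biset : biset (coset_of N) gT := Biset def_biset_on.

Definition Infl : burnside gT (coset_of N) := bclass inf_biset.
Definition Defl : burnside (coset_of N) gT := bclass def_biset.

Lemma Infl_opp : bopp Infl = Defl.
Proof.
rewrite /Infl boppE; apply: bclass_iso.
exists (fun c : coset_of N => c^-1)%g; split.
- by exists (fun c => c^-1)%g => c; rewrite /= invgK.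
- by move=> d c /=; rewrite invMg invgK.
- by move=> c g /=; rewrite invMg cosetV invgK.
Qed.

Lemma Defl_opp : bopp Defl = Infl. Proof. by rewrite -Infl_opp boppK. Qed.

Lemma Defl_Infl : bcomp Defl Infl = 1.
Proof.
rewrite /Defl /Infl bcompE; apply: bclass_iso.
pose F (c : def_biset) (d : inf_biset) : id_biset (coset_of N) := (c * d)%g.
have Fb c h d : F (ract def_biset c h) d = F c (lact inf_biset h d).
  by rewrite /F /= mulgA.
exists (tfactor Fb); split.
- exists (fun c => tclass (c : def_biset, 1%g : inf_biset)).
  + elim/tclassW=> c d; rewrite tfactorE /F.
    have {2}-> : d = lact inf_biset (fingroup.repr d) 1%g by rewrite /= coset_reprK mulg1.
    by rewrite -tclass_bal /= coset_reprK.
  + by move=> c; rewrite tfactorE /F mulg1.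
- by move=> g; elim/tclassW=> c d; rewrite tensor_lE !tfactorE /F /= mulgA.
- by elim/tclassW=> c d h; rewrite tensor_rE !tfactorE /F /= mulgA.
Qed.

Definition dbinf (u : burnside (coset_of N) (coset_of N)) : burnside gT gT :=
  1 + bcomp (bcomp Infl (u - 1)) Defl.

Lemma dbinf1 : dbinf 1 = 1.
Proof. by rewrite /dbinf subrr bcomp0r bcomp0l addr0. Qed.

Lemma dbinfM : {morph dbinf : u v / u * v}.
Proof.
move=> u v; rewrite /dbinf mulrDl !mulrDr !mul1r mulr1 -!addrA; congr (_ + _).
have -> : bcomp (bcomp Infl (u - 1)) Defl * bcomp (bcomp Infl (v - 1)) Defl =
          bcomp (bcomp Infl ((u - 1) * (v - 1))) Defl.
  rewrite -[LHS]bcompA [bcomp Defl _]bcompA [bcomp Defl (bcomp _ _)]bcompA.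
  by rewrite Defl_Infl bcomp1l !bcompA.
rewrite -!bcompDl -!bcompDr; congr (bcomp (bcomp _ _) _).
by rewrite mulrBr mulr1 [u - 1 + _]addrC subrK mulrBl mul1r [RHS]addrC addrA subrK.
Qed.

Lemma dbinf_opp u : bopp (dbinf u) = dbinf (bopp u).
Proof.
by rewrite /dbinf boppD bopp1 !bopp_comp Defl_opp Infl_opp boppB bopp1 bcompA.
Qed.

Lemma dbinf_orthogonal u : orthogonal u -> orthogonal (dbinf u).
Proof.
case/andP=> /eqP u1 /eqP u2.
by rewrite /orthogonal dbinf_opp -!dbinfM u1 u2 dbinf1 eqxx.
Qed.

Definition dBInf (u : orthunit (coset_of N)) : orthunit gT :=
  OrthUnit (dbinf_orthogonal (valP u)).

Lemma dBInfM : {morph dBInf : u v / (u * v)%g}.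
Proof. by move=> u v; apply/val_inj/dbinfM. Qed.
End DBInf.

Section CosetBiset.
Variables (gT hT : finGroupType) (L : {group gT * hT}).

Record lcoset_car := LcosetCar {
  lcoset_set : {set gT * hT};
  _ : lcoset_set \in lcosets L [set: gT * hT]%SET }.
HB.instance Definition _ := [isSub for lcoset_set].
HB.instance Definition _ := [Finite of lcoset_car by <:].

Lemma lcoset_carP (p : gT * hT) (S : lcoset_car) :
  p *: val S \in lcosets L [set: gT * hT]%SET.
Proof.
case: S => S /= /lcosetsP[q _ ->]; rewrite -lcosetM.
by apply/lcosetsP; exists (p * q); rewrite ?inE.
Qed.

Definition lcoset_act p S : lcoset_car := LcosetCar (lcoset_carP p S).

Lemma lcoset_act1 S : lcoset_act 1 S = S.
Proof. by apply: val_inj; rewrite /= lcoset1. Qed.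

Lemma lcoset_actM p q S : lcoset_act (p * q) S = lcoset_act p (lcoset_act q S).
Proof. by apply: val_inj; rewrite /= lcosetM. Qed.

Definition coset_biset_on : biset_on gT hT lcoset_car.
Proof.
exists (fun x S => lcoset_act (x, 1) S) (fun S y => lcoset_act (1, y^-1) S).
- exact: lcoset_act1.
- move=> g g' S; rewrite -lcoset_actM; congr (lcoset_act (_, _) _).
  by rewrite mulg1.
- by move=> S; rewrite invg1 lcoset_act1.
- move=> S h h'; rewrite -lcoset_actM; congr (lcoset_act (_, _) _).
    by rewrite mulg1.
  by rewrite invMg.
- move=> g S h; rewrite -!lcoset_actM; congr (lcoset_act (_, _) _).
    by rewrite mulg1 mul1g.
  by rewrite mulg1 mul1g.
Defined.

Definition coset_biset : biset gT hT := Biset coset_biset_on.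

Definition K1 : {set gT} := [set g | (g, 1) \in L]%SET.
Definition K2 : {set hT} := [set h | (1, h) \in L]%SET.
Definition bifree : bool := (K1 == 1) && (K2 == 1).
End CosetBiset.

(* [L] runs over all bifree subgroups rather than conjugacy representatives;
   conjugate subgroups have isomorphic coset bisets, so the span is the same. *)
Definition burnside_bifree (gT : finGroupType) : set (burnside gT gT) :=
  fun u => exists c : {group gT * gT} -> int,
    (u = \sum_(L | bifree L) bclass (coset_biset L) *~ c L)%R.

Section Subgroups.
Local Open Scope classical_set_scope.
Variable T : groupType.

Definition is_subgroup (A : set T) : Prop :=
  A 1 /\ forall x y, A x -> A y -> A (x * y^-1).

Definition generated (S : set T) : set T := smallest is_subgroup S.

Definition elem_abelian2 (A : set T) : Prop :=
  [/\ is_subgroup A, forall x y, A x -> A y -> x * y = y * x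
    & forall x, A x -> x ^+ 2 = 1].
End Subgroups.

Definition nb_normal (gT : finGroupType) : nat :=
  #|[set N : {group gT} | N <| [set: gT]]%SET|.

Section OrthSubgroups.
Local Open Scope classical_set_scope.
Variable gT : finGroupType.

Definition orthunit_bifree : set (orthunit gT) :=
  [set u | burnside_bifree (ouval u)].

Definition HdB : set (orthunit gT) :=
  generated [set u | exists (N : {group gT}) (nN : N <| [set: gT]%G),
                     u = dBInf nN (ouN 1)].
End OrthSubgroups.
Arguments orthunit_bifree : clear implicits.
Arguments HdB : clear implicits.

(* Main.v *)
From HB Require Import structures.
From mathcomp Require Import all_boot all_order all_algebra all_fingroup.
From mathcomp Require Import boolp classical_sets cardinality.
Require Import Defs.

Set Implicit Arguments.
Unset Strict Implicit.
Unset Printing Implicit Defensive.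

Import GRing.Theory Num.Theory.

(** Write e_N for Inf o Def, the class of the biset G/N.  The generator
    attached to N is 1 - 2 e_N.  Since G/N and G/M compose to G/NM, the e_N are
    commuting idempotents, so the generators are commuting involutions; hence
    their group consists of the products s_S of the generators attached to the
    N in S, where S runs over the sets of normal subgroups, and S |-> s_S turns
    symmetric difference into multiplication.  Everything else follows from one
    fact ([dB_prod_bifree]): if s_S lies in the bifree subring, then S is empty
    or S = {1}, that is, s_S = 1 or s_S = -1.  In particular s_S = 1 forces S
    to be empty, so the products are pairwise distinct and there are 2^n of
    them.

    To detect the e_N, count in a biset X the points whose left stabilizer is
    exactly a given normal subgroup M.  This count is additive, so it extends
    to an additive map psi_M on the Burnside group ([lstab_mark]), and
    - psi_M (e_N) is nonzero exactly when N = M, because all points of G/N have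
      left stabilizer N;
    - psi_M (e_N y) = 0 for every y unless N <= M, because N acts trivially on
      the left of any biset of the form G/N x_G Y;
    - psi_M vanishes on the bifree subring when M <> 1, because left
      stabilizers in a bifree coset biset are trivial.
    Suppose now that s_S is bifree and that S contains a nontrivial subgroup,
    and let M be a smallest such one.  Multiplying by the generator of any
    other N in S does not change the absolute value of psi_M: the generator of
    the trivial group is -1, and the remaining N are not contained in M.  So
    |psi_M (s_S)| = |psi_M (1 - 2 e_M)| = 2 |psi_M (e_M)| <> 0, which is
    absurd. *)

(** * Groups generated by finitely many commuting involutions *)

Section CommutingInvolutions.
Local Open Scope group_scope.
Variables (T : groupType) (I : finType) (s : I -> T).
Hypotheses (s_comm : forall i j, commute (s i) (s j))
           (s_inv : forall i, s i * s i = 1).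

Definition subset_prod (S : {set I}) : T := \prod_(i in S) s i.

Definition symdiff (S R : {set I}) : {set I} := (S :\: R :|: R :\: S)%SET.

(** Where S and R overlap the involution occurs twice and cancels: S |-> product
    is a morphism from the group of subsets under symmetric difference. *)
Lemma subset_prodM S R :
  subset_prod S * subset_prod R = subset_prod (symdiff S R).
Proof.
rewrite /subset_prod big_mkcond [X in _ * X]big_mkcond [RHS]big_mkcond /=.
rewrite -prodgM_commute; last first.
  move=> i j _ _; do 2!case: ifP => _; rewrite /commute ?mulg1 ?mul1g //.
  exact: s_comm.
apply: eq_bigr => i _; rewrite !inE.
by case: (i \in S); case: (i \in R); rewrite ?mulg1 ?mul1g ?s_inv.
Qed.

Lemma symdiff_eq0 S R : symdiff S R = finset.set0 -> S = R.
Proof.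
move/setP=> E; apply/setP=> i; have := E i; rewrite !inE.
by case: (i \in S); case: (i \in R).
Qed.

Lemma subset_prod0 : subset_prod finset.set0 = 1.
Proof. by rewrite /subset_prod big_set0. Qed.

Lemma subset_prod1 i : subset_prod [set i]%SET = s i.
Proof. by rewrite /subset_prod big_set1. Qed.

Lemma subset_prod_sqr S : subset_prod S * subset_prod S = 1.
Proof.
by rewrite subset_prodM /symdiff finset.setDv finset.setU0 subset_prod0.
Qed.

Lemma subset_prodV S : (subset_prod S)^-1 = subset_prod S.
Proof. by apply: (mulgI (subset_prod S)); rewrite mulgV subset_prod_sqr. Qed.

Lemma subset_prodC S R :
  subset_prod S * subset_prod R = subset_prod R * subset_prod S.
Proof. by rewrite !subset_prodM /symdiff finset.setUC. Qed.

(** By [subset_prodM] the products over subsets already form a subgroup. *)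
Lemma generated_involutions : generated (range s) = range subset_prod.
Proof.
rewrite /generated; apply/seteqP; split=> [x | _ [S _ <-] A [[A1 AV] sA]].
- apply; split; first split.
  + by exists finset.set0 => //; exact: subset_prod0.
  + move=> _ _ [S _ <-] [R _ <-]; exists (symdiff S R) => //.
    by rewrite subset_prodV subset_prodM.
  + by move=> _ [i _ <-]; exists [set i]%SET => //; exact: subset_prod1.
have AM x y : A x -> A y -> A (x * y).
  by move=> Ax /(AV _ _ A1); rewrite mul1g => /(AV _ _ Ax); rewrite invgK.
by apply: (big_ind A) => // i _; apply: sA; exists i.
Qed.

Lemma elem_abelian2_involutions : elem_abelian2 (generated (range s)).
Proof.
split.
- split=> [A [[A1 _] _] // | x y gx gy A sA].
  by case: (sA) => -[_ AV] _; apply: AV; [apply: gx | apply: gy].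
- rewrite generated_involutions => _ _ [S _ <-] [R _ <-]; exact: subset_prodC.
- rewrite generated_involutions => _ [S _ <-]; exact: subset_prod_sqr.
Qed.

Local Open Scope card_scope.
Local Open Scope classical_set_scope.

(** The hypothesis says that the morphism [subset_prodM] has trivial kernel;
    the group is then in bijection with the subsets of the index type. *)
Lemma card_generated_involutions :
    (forall S, subset_prod S = 1 -> S = finset.set0) ->
  generated (range s) #= `I_(2 ^ #|I|).
Proof.
move=> s_free; rewrite generated_involutions.
have inj : injective subset_prod.
  move=> S R eqSR; apply/symdiff_eq0/s_free.
  by rewrite -subset_prodM eqSR subset_prod_sqr.
apply: card_eq_trans (inj_card_eq (in2W inj)) _.
pose rank (S : {set I}) : nat := val (enum_rank S).
have rank_inj : injective rank by exact: inj_comp val_inj enum_rank_inj.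
have cardS : #|{set I}| = (2 ^ #|I|)%N.
  by rewrite -(cardsT I) -card_powerset finset.powersetT cardsT.
rewrite card_eq_sym -cardS.
suff <- : range rank = `I_#|{set I}| by exact: inj_card_eq (in2W rank_inj).
apply/seteqP; split=> [_ [S _ <-] | k ltk]; first exact: ltn_ord.
by exists (enum_val (Ordinal ltk)) => //; rewrite /rank enum_valK.
Qed.
End CommutingInvolutions.

(** * Bisets isomorphic to a quotient G/N *)

Section QuotientPoint.
Local Open Scope group_scope.
Variable gT : finGroupType.
Implicit Types (X Y : biset gT gT) (N M : {set gT}).

(** The features of the point N of the biset G/N, which characterize that biset
    ([quotient_point_iso]).  They make it possible to recognize G/N in its
    various presentations without ever forming a quotient, and [N] need not be
    given as a group, so that a product of two subgroups is allowed. *)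
Definition quotient_point X N (x : X) :=
  [/\ forall y, exists g, y = lact X g x,
      forall g, lact X g x = ract X x g
    & forall g, lact X g x = x <-> g \in N].

Lemma lact_eq X N x g h : quotient_point N x ->
  lact X g x = lact X h x <-> h^-1 * g \in N.
Proof.
case=> _ _ stab; rewrite -stab lactM; split=> [-> | /(congr1 (lact X h))].
  by rewrite -lactM mulVg lact1.
by rewrite -lactM mulgV lact1.
Qed.

(** Such a biset is recovered from [N]: its points are the g x, with
    g x = h x read off from [N], and the right action is (g x) h = (g h) x. *)
Lemma quotient_point_iso X Y N x y :
  quotient_point (X := X) N x -> quotient_point (X := Y) N y -> biset_iso X Y.
Proof.
move=> qx qy; have [tx cx _] := qx; have [ty cy _] := qy.
pose f z := lact Y (projT1 (cid (tx z))) y.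
pose k z := lact X (projT1 (cid (ty z))) x.
have fE g : f (lact X g x) = lact Y g y.
  rewrite /f; case: cid => h /= E.
  exact/esym/(lact_eq _ _ qy)/(lact_eq _ _ qx).
have kE g : k (lact Y g y) = lact X g x.
  rewrite /k; case: cid => h /= E.
  exact/esym/(lact_eq _ _ qx)/(lact_eq _ _ qy).
exists f; split.
- exists k => z; first by have [g ->] := tx z; rewrite fE kE.
  by have [g ->] := ty z; rewrite kE fE.
- by move=> g z; have [h ->] := tx z; rewrite -lactM !fE lactM.
- move=> z h; have [g ->] := tx z.
  by rewrite -lractA -cx -lactM !fE lactM cy lractA.
Qed.

(** G/N composed with G/M is G/NM: in the tensor product g (x, y) = (x, y)
    means that, for some h, h fixes y and g h^-1 fixes x. *)
Lemma quotient_point_tensor X Y N M x y :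
  quotient_point (X := X) N x -> quotient_point (X := Y) M y ->
  quotient_point (X := tensor X Y) (N * M) (tclass (x, y)).
Proof.
case=> tx cx sx [ty cy sy]; split.
- elim/tclassW=> x' y'; have [g ->] := tx x'; have [h ->] := ty y'.
  by exists (g * h); rewrite -tclass_bal -lractA -cx -lactM tensor_lE.
- by move=> g; rewrite tensor_lE tensor_rE -cy -tclass_bal cx.
- move=> g; rewrite tensor_lE; split.
    case/tclassP=> h /= [xE yE]; apply/mulsgP; exists (g * h^-1) h.
    + by apply/sx; rewrite lactM cx lractA.
    + by apply/sy.
    + by rewrite mulgKV.
  case/mulsgP=> n m /sx xE /sy yE ->.
  by rewrite lactM cx lractA xE tclass_bal yE.
Qed.

Lemma quotient_point_id : quotient_point (X := id_biset gT) 1 1.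
Proof.
split=> [g | g | g] /=; first by exists g; rewrite mulg1.
  by rewrite mulg1 mul1g.
by rewrite mulg1 inE; split=> [-> | /eqP].
Qed.

Lemma quotient_point_inf_def (N : {group gT}) (nN : N <| [set: gT]%G) :
  quotient_point (X := tensor (inf_biset nN) (def_biset nN)) N
    (tclass (1 : inf_biset nN, 1 : def_biset nN)).
Proof.
have nNG g : g \in 'N(N).
  by apply: (fintype.subsetP (normal_norm nN)); rewrite inE.
split.
- elim/tclassW=> c d.
  have [g gE] : exists g, coset N g = (c : coset_of N) * d.
    by eexists; apply: coset_reprK.
  exists g; rewrite tensor_lE /= mulg1 gE.
  by rewrite -[d in LHS]mulg1 -[d * 1]/(lact (def_biset nN) d 1) -tclass_bal.
- move=> g; rewrite tensor_lE tensor_rE /= mulg1 mul1g.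
  rewrite -[coset N g in RHS]mulg1.
  by rewrite -[_ * 1]/(lact (def_biset nN) (coset N g) 1) -tclass_bal /= mul1g.
- move=> g; rewrite tensor_lE /= mulg1; split=> [/tclassP[h E] | gN].
    (* These equations are stated in the quotient group: simplifying [E] would
       turn them into equations between subsets of [gT]. *)
    have Ec : 1 = coset N g * h^-1 := congr1 fst E.
    have Eh : 1 = h * 1 := congr1 snd E.
    by apply: coset_idr => //; rewrite Ec -[h]mulg1 -Eh invg1 mulg1.
  by rewrite coset_id.
Qed.

Definition diagonal : {set gT * gT} := [set p | p.1 == p.2]%SET.

Lemma diagonal_group_set : group_set diagonal.
Proof.
apply/group_setP; split=> [|[a b] [c d]]; rewrite !inE //=.
by move=> /eqP-> /eqP->.
Qed.
Canonical diagonal_group := Group diagonal_group_set.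

Lemma bifree_diagonal : bifree diagonal_group.
Proof.
by apply/andP; split; apply/eqP/setP=> g; rewrite !inE /= ?[1 == g]eq_sym.
Qed.

(** The identity biset as a coset biset: it is G x G modulo the diagonal, with
    (a, b) corresponding to a b^-1. *)
Lemma quotient_point_diagonal :
  exists S, quotient_point (X := coset_biset diagonal_group) 1 S.
Proof.
have diagP p : p *: diagonal \in lcosets diagonal [set: gT * gT]%SET.
  by apply/lcosetsP; exists p; rewrite ?inE.
have diag_eq p q : p *: diagonal = q *: diagonal <->
    p.1^-1 * q.1 = p.2^-1 * q.2.
  split=> [/esym/lcoset_eqP | E]; first by rewrite mem_lcoset inE => /eqP.
  by apply/esym/lcoset_eqP; rewrite mem_lcoset inE; apply/eqP.
have diagI p q : LcosetCar (diagP p) = LcosetCar (diagP q) <->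
    p.1^-1 * q.1 = p.2^-1 * q.2.
  by rewrite -diag_eq; split=> [/(congr1 val) // | ?]; apply: val_inj.
have actE p q : lcoset_act p (LcosetCar (diagP q)) = LcosetCar (diagP (p * q)).
  by apply: val_inj; rewrite /= lcosetM.
exists (LcosetCar (diagP 1)); split.
- case=> _ /[dup] /lcosetsP[[a b] _ ->] abP; exists (a * b^-1).
  have -> : LcosetCar abP = LcosetCar (diagP (a, b)) by exact: val_inj.
  rewrite /= actE.
  by apply/diagI; rewrite /= !mulg1 mulKg.
- by move=> g; rewrite /= !actE; apply/diagI; rewrite /= !mulg1 invg1 mul1g.
- move=> g; rewrite /= actE diagI /= !mulg1 inE invg1; split=> [/eqP|/eqP->].
    by rewrite invg_eq1.
  by rewrite invg1.
Qed.

End QuotientPoint.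

(** * Counting the points with a given left stabilizer *)

Section LeftStabilizer.
Local Open Scope group_scope.
Variables gT hT : finGroupType.
Implicit Types (X Y : biset gT hT) (M N : {set gT}).

Definition lstab X (x : X) : {set gT} := [set g | lact X g x == x]%SET.

Definition lstab_count M X : nat := \sum_(x : X) (lstab x == M).

Lemma lstab_count_iso M X Y :
  biset_iso X Y -> lstab_count M X = lstab_count M Y.
Proof.
case=> f [bij_f fl _]; rewrite /lstab_count (reindex f); last exact: onW_bij.
apply: eq_bigr => x _; congr (nat_of_bool (_ == M)); apply/setP=> g.
by rewrite !inE -fl (inj_eq (bij_inj bij_f)).
Qed.

Lemma lstab_countD M X Y :
  lstab_count M (sum_biset X Y) = (lstab_count M X + lstab_count M Y)%N.
Proof. by rewrite /lstab_count big_sumType. Qed.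

Lemma lstab_count_eq0 M X : (forall x : X, lstab x != M) -> lstab_count M X = 0.
Proof. by move=> nM; apply: big1 => x _; rewrite (negPf (nM x)). Qed.

Local Open Scope ring_scope.

Definition lstab_mark M (u : burnside gT hT) : int :=
  glift (fun c => (lstab_count M (irepr c))%:Z) u.

Let countD M : {morph (fun c : isoclass gT hT => (lstab_count M (irepr c))%:Z) :
  c d / c + d}.
Proof.
move=> c d; rewrite -PoszD -lstab_countD; congr Posz.
by apply/lstab_count_iso/irepr_iso.
Qed.

Fact lstab_mark_is_zmod_morphism M : zmod_morphism (lstab_mark M).
Proof. exact: gliftB (@countD M). Qed.

HB.instance Definition _ M :=
  GRing.isZmodMorphism.Build (burnside gT hT) int (lstab_mark M)
    (lstab_mark_is_zmod_morphism M).

Lemma lstab_mark_bclass M X : lstab_mark M (bclass X) = (lstab_count M X)%:Z.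
Proof.
rewrite /lstab_mark gliftc; last exact: countD.
by rewrite (lstab_count_iso _ (irepr_iso X)).
Qed.

End LeftStabilizer.

(** * Classes of quotient bisets and their marks *)

Section QuotientClass.
Local Open Scope group_scope.
Variable gT : finGroupType.
Implicit Types (X : biset gT gT) (M N : {group gT}).

(** The left stabilizers in G/N are the conjugates of the normal subgroup [N]. *)
Lemma lstab_quotient_point X N x (y : X) :
  N <| [set: gT] -> quotient_point (X := X) N x -> lstab y = N.
Proof.
move=> nN qx; have [tx _ _] := qx; have [g ->] := tx y.
apply/setP=> k; rewrite inE -[LHS]/(_ == _) -lactM.
have -> : (lact X (k * g) x == lact X g x) = (k ^ g \in N).
  by apply/eqP/idP => /(lact_eq _ _ qx).
by rewrite memJ_norm // (fintype.subsetP (normal_norm nN)) ?inE.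
Qed.

Lemma quotient_point_trivl X N x n (y : X) :
  N <| [set: gT] -> quotient_point (X := X) N x -> n \in N -> lact X n y = y.
Proof.
by move=> nN qx; rewrite -(lstab_quotient_point y nN qx) inE => /eqP.
Qed.

Definition quotient_class (N : {set gT}) (u : burnside gT gT) : Prop :=
  exists X x, u = bclass X /\ quotient_point (X := X) N x.

Lemma quotient_class_inj (N : {set gT}) u v :
  quotient_class N u -> quotient_class N v -> u = v.
Proof.
move=> [X [x [-> qx]]] [Y [y [-> qy]]].
exact/bclass_iso/(quotient_point_iso qx qy).
Qed.

Lemma quotient_class1 : quotient_class 1 1%R.
Proof. by exists (id_biset gT), 1; split=> //; exact: quotient_point_id. Qed.

Lemma quotient_classM (N M : {set gT}) u v :
  quotient_class N u -> quotient_class M v -> quotient_class (N * M) (u * v)%R.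
Proof.
move=> [X [x [-> qx]]] [Y [y [-> qy]]]; exists (tensor X Y), (tclass (x, y)).
by split; [exact: bcompE | exact: quotient_point_tensor].
Qed.

Lemma quotient_class_inf_def N (nN : N <| [set: gT]%G) :
  quotient_class N (bcomp (Infl nN) (Defl nN)).
Proof.
rewrite /Infl /Defl bcompE; do 2!eexists; split=> //.
exact: quotient_point_inf_def.
Qed.

(** Both products are the class of G/NM = G/MN. *)
Lemma quotient_classC N M u v : M <| [set: gT] ->
  quotient_class N u -> quotient_class M v -> (u * v = v * u)%R.
Proof.
move=> nM qu qv; have NM : (N * M = M * N :> {set gT})%g.
  apply: normC; apply: fintype.subset_trans (normal_norm nM).
  exact: finset.subsetT.
apply: (quotient_class_inj (quotient_classM qu qv)); rewrite NM.
exact: quotient_classM.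
Qed.

Local Open Scope ring_scope.

Lemma lstab_mark_quotient M N u : N <| [set: gT]%g -> quotient_class N u ->
  (lstab_mark M u != 0) = (N == M :> {set gT}).
Proof.
move=> nN [X [x [-> qx]]]; rewrite lstab_mark_bclass.
rewrite /lstab_count (eq_bigr (fun=> (N == M :> {set gT}) : nat)); last first.
  by move=> y _; rewrite (lstab_quotient_point y nN qx).
rewrite sum_nat_const; case: ((N : {set gT}) == M); last by rewrite muln0.
by rewrite muln1 -lt0n; apply/card_gt0P; exists x.
Qed.

(** [N] fixes every point of G/N on the left, hence every point of any biset
    G/N x_G Y, so no left stabilizer there can be equal to [M]. *)
Lemma lstab_mark_quotientM M N u v : N <| [set: gT]%g -> quotient_class N u ->
  ~~ (N \subset M) -> lstab_mark M (u * v) = 0.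
Proof.
move=> nN [X [x [-> qx]]] sNM; elim/burnside_ind: v => [Y|v w IHv IHw].
  rewrite [_ * _]bcompE lstab_mark_bclass lstab_count_eq0 //.
  elim/tclassW=> y z; apply: contraNneq sNM => <-.
  apply/fintype.subsetP=> n nNn; rewrite inE tensor_lE.
  by rewrite (quotient_point_trivl _ nN qx).
by rewrite mulrBr raddfB /= IHv IHw subrr.
Qed.

(** An element g of the left stabilizer of the coset (a, b) L satisfies
    (g ^ a, 1) \in L, that is, g ^ a belongs to the trivial group [K1 L]. *)
Lemma lstab_mark_bifree M u :
  M != 1%G -> burnside_bifree u -> lstab_mark M u = 0.
Proof.
move=> ntM [c ->]; rewrite raddf_sum big1 // => L bL.
rewrite raddfMz /= lstab_mark_bclass lstab_count_eq0 ?mul0rz // => S.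
apply: contra ntM => /eqP stabS.
have /lcosetsP[[a b] _ SE] := valP S.
apply/eqP/val_inj/trivgP; rewrite -stabS.
apply/fintype.subsetP=> g; rewrite !inE => /eqP/(congr1 val) /=.
rewrite SE -lcosetM => /lcoset_eqP; rewrite mem_lcoset /=.
have -> : ((a, b)^-1 * ((g, 1) * (a, b)) = (g ^ a, 1) :> gT * gT)%g.
  by congr (_, _); rewrite /= ?mul1g ?mulVg.
case/andP: bL => /eqP/setP/(_ (g ^ a)%g) + _.
by rewrite !inE => ->; rewrite conjg_eq1.
Qed.

Lemma bifree1 : burnside_bifree (1 : burnside gT gT).
Proof.
exists (fun L => (L == diagonal_group gT)%:Z).
rewrite (bigD1 (diagonal_group gT)) ?bifree_diagonal //= eqxx mulr1z.
rewrite big1 ?addr0 => [|L /andP[_ /negPf->]]; last by rewrite mulr0z.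
apply: quotient_class_inj quotient_class1 _.
have [S qS] := quotient_point_diagonal gT.
by exists (coset_biset (diagonal_group gT)), S.
Qed.

Lemma bifreeN (u : burnside gT gT) : burnside_bifree u -> burnside_bifree (- u).
Proof.
case=> c ->; exists (fun L => - c L); rewrite -sumrN.
by apply: eq_bigr => L _; rewrite mulrNz.
Qed.
End QuotientClass.

(** * The group generated by the units dBInf (- Id) *)

Section DeflationInflationGroup.
Local Open Scope group_scope.
Variable gT : finGroupType.

(** As [dBInf] takes a proof of normality, its values can be multiplied over a
    finite index type only once that proof is part of the index. *)
Definition normal_subgroup := {N : {group gT} | N <| [set: gT]}.

Implicit Types (M N : normal_subgroup).

Definition inf_def N : burnside gT gT := bcomp (Infl (valP N)) (Defl (valP N)).

Definition dBInfN1 N : orthunit gT := dBInf (valP N) (ouN 1).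

Definition triv_normal : normal_subgroup := exist _ 1%G (normal1 [set: gT]).

Local Open Scope ring_scope.

Lemma dBInfN1E N : dBInfN1 N = 1 - inf_def N *+ 2 :> burnside gT gT.
Proof.
rewrite /= /dbinf /inf_def -opprD bcompNr bcompNl bcompDr bcomp1r bcompDl.
by rewrite mulr2n.
Qed.

Lemma inf_def_class N : quotient_class (val N) (inf_def N).
Proof. exact: quotient_class_inf_def. Qed.

Lemma ouvalM (u v : orthunit gT) : ouval (u * v)%g = ouval u * ouval v.
Proof. by []. Qed.

Lemma dBInfN1_comm M N : commute (dBInfN1 M) (dBInfN1 N).
Proof.
apply: val_inj; rewrite [LHS]ouvalM [RHS]ouvalM !dBInfN1E.
suff c : GRing.comm (inf_def M) (inf_def N).
  apply: commrB (commr1 _) _; apply: commrMn; apply/commr_sym.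
  by apply: commrB (commr1 _) _; apply: commrMn; apply/commr_sym.
exact: (quotient_classC (valP N) (inf_def_class M) (inf_def_class N)).
Qed.

Lemma dBInfN1_inv N : (dBInfN1 N * dBInfN1 N = 1)%g.
Proof.
rewrite -dBInfM; apply: val_inj; rewrite /= mulrNN mulr1; exact: dbinf1.
Qed.

Lemma dBInfN1_triv : dBInfN1 triv_normal = ouN 1%g.
Proof.
apply: val_inj; rewrite [LHS]dBInfN1E.
have -> : inf_def triv_normal = 1.
  apply: (quotient_class_inj (inf_def_class triv_normal)).
  exact: quotient_class1.
by rewrite mulr2n opprD addrA subrr sub0r.
Qed.

Lemma HdB_range : HdB gT = generated (range dBInfN1).
Proof.
congr generated; apply/seteqP; split=> [u [N [nN ->]] | u [N _ <-]].
  by exists (exist _ N nN) => //; congr (dBInf _ _); apply: eq_irrelevance.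
by exists (val N), (valP N).
Qed.

Lemma card_normal_subgroup : #|{: normal_subgroup}| = nb_normal gT.
Proof. by rewrite card_sig /nb_normal cardsE. Qed.

Notation dB_prod := (subset_prod dBInfN1).

(** Each factor 1 - 2 e_N preserves the mark at [M] up to sign: for N = 1 it is
    -1, and otherwise e_N contributes nothing by [lstab_mark_quotientM]. *)
Lemma lstab_mark_dB_prodM M (S : {set normal_subgroup}) (u : burnside gT gT) :
    {in S, forall N, (N == triv_normal) || ~~ (val N \subset val M)} ->
  `|lstab_mark (val M) (ouval (dB_prod S) * u)| = `|lstab_mark (val M) u|.
Proof.
move=> Sout; move: u; rewrite /subset_prod.
apply: (big_ind (fun w : orthunit gT => forall u : burnside gT gT,
   `|lstab_mark (val M) (ouval w * u)| = `|lstab_mark (val M) u|)).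
- by move=> u; rewrite mul1r.
- by move=> v w IHv IHw u; rewrite ouvalM -mulrA IHv.
move=> N /Sout/orP[/eqP-> u | sNM u].
  by rewrite dBInfN1_triv mulN1r raddfN normrN.
rewrite dBInfN1E mulrBl mul1r raddfB mulrnAl raddfMn /=.
by rewrite (lstab_mark_quotientM _ (valP N) (inf_def_class N) sNM) mul0rn subr0.
Qed.

(** A smallest nontrivial member of [S] would be detected by its own mark, which
    vanishes on the bifree subring. *)
Lemma dB_prod_bifree (S : {set normal_subgroup}) :
  burnside_bifree (ouval (dB_prod S)) -> S \subset [set triv_normal]%SET.
Proof.
move=> Sfree; apply: contraT => /subsetPn[N0 SN0 ntN0].
pose P N := (N \in S) && (N != triv_normal).
have PN0 : P N0 by rewrite /P SN0; rewrite inE in ntN0.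
case: (arg_minnP (fun N => #|val N|) PN0) => M /andP[SM ntM] minM.
have ntM' : val M != 1%G by rewrite -val_eqE in ntM.
(* The factor of [M] goes to the right, where it is the argument on which the
   mark is evaluated once the other factors are stripped off. *)
have SE : dB_prod S = (dB_prod (S :\ M) * dBInfN1 M)%g.
  rewrite -(subset_prod1 dBInfN1 M) (subset_prodM dBInfN1_comm dBInfN1_inv).
  congr subset_prod; apply/setP=> N; rewrite !inE.
  by case: eqP => [->|_]; rewrite ?SM ?andbF ?orbF.
have out : {in S :\ M, forall N,
    (N == triv_normal) || ~~ (val N \subset val M)}.
  move=> N; rewrite !inE => /andP[neqNM SN]; case: eqP => //= /eqP ntN.
  apply: contra neqNM => sNM; apply/eqP/val_inj/val_inj/eqP.
  by rewrite eqEcard sNM /=; apply: minM; rewrite /P SN.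
have := lstab_mark_bifree ntM' Sfree.
move/(congr1 Num.norm); rewrite SE ouvalM.
rewrite lstab_mark_dB_prodM // normr0 dBInfN1E raddfB raddfMn /=.
have /negbFE/eqP-> : (lstab_mark (val M) (1 : burnside gT gT) != 0) = false.
  rewrite (lstab_mark_quotient _ (normal1 _) (quotient_class1 gT)).
  by rewrite eq_sym; apply/negbTE.
have : lstab_mark (val M) (inf_def M) != 0.
  by rewrite (lstab_mark_quotient _ (valP M) (inf_def_class M)).
by rewrite sub0r normrN => ntm /eqP; rewrite normr_eq0 mulrn_eq0 (negPf ntm).
Qed.

(** After [dB_prod_bifree] only -1 = 1 is left to exclude: the mark of 1 at the
    trivial subgroup is a nonzero integer. *)
Lemma dB_prod_eq1 (S : {set normal_subgroup}) :
  dB_prod S = 1%g -> S = finset.set0.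
Proof.
move=> S1; have := @dB_prod_bifree S; rewrite S1 => /(_ (bifree1 gT)).
rewrite finset.subset1 => /orP[/eqP SE | /eqP //].
move: S1; rewrite SE subset_prod1 dBInfN1_triv.
(* The marks are integers, where x = - x forces x = 0. *)
move/(congr1 (lstab_mark 1%g \o @ouval gT)) => /= /eqP.
rewrite raddfN /= -subr_eq0 -opprD oppr_eq0 -mulr2n mulrn_eq0 /=.
have := lstab_mark_quotient 1%G (normal1 _) (quotient_class1 gT).
by rewrite eqxx => /negPf ->.
Qed.
End DeflationInflationGroup.

Local Open Scope classical_set_scope.
Local Open Scope card_scope.

Theorem theorem4p6 (gT : finGroupType) :
  [/\ elem_abelian2 (HdB gT),
      HdB gT #= `I_(2 ^ nb_normal gT)
    & orthunit_bifree gT `&` HdB gT = [set (1%g : orthunit gT); ouN 1%g] ].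
Proof.
have s_comm := @dBInfN1_comm gT; have s_inv := @dBInfN1_inv gT.
rewrite HdB_range -card_normal_subgroup; split.
- exact: elem_abelian2_involutions.
- by apply: card_generated_involutions => // S; apply: dB_prod_eq1.
rewrite generated_involutions //; apply/seteqP; split.
  move=> _ [/[swap] [[S _ <-]] /dB_prod_bifree]; rewrite finset.subset1.
  case/orP=> /eqP->; [right | left]; last exact: subset_prod0.
  by rewrite subset_prod1; apply: dBInfN1_triv.
move=> _ [] ->; split; [exact: bifree1 | | exact/bifreeN/bifree1 | ].
- by exists finset.set0 => //; apply: subset_prod0.
- by exists [set triv_normal gT]%SET => //; rewrite subset_prod1 dBInfN1_triv.
Qed.
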